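(* Let $\mathbb{F}$ be a field. A $\rho/\lambda/\beta/\nu$-configuration of $n$ positions (that is, an assignment of one of the symbols $\rho,\lambda,\beta,\nu$ to each of the positions $1,\dots,n$) represents the signature of a subspace of $\mathbb{F}^{n}$ if and only if the number of $\lambda$-positions equals the number of $\rho$-positions, and to the right of every $\lambda$-position there are more $\rho$-positions than $\lambda$-positions.
   Context: $\mathbb{F}$ is an arbitrary field. A non-zero vector in $\mathbb{F}^n$ terminates in the $j$-th position if its last non-zero entry is in the $j$-th position, and originates in the $j$-th position if its first non-zero entry is in the $j$-th position. For a subspace $\mathcal{W}$ of $\mathbb{F}^n$, an index $j\in\{1,\dots,n\}$ is red for $\mathcal{W}$ if $\mathcal{W}$ contains an element that terminates in the $j$-th position, and lime for $\mathcal{W}$ if $\mathcal{W}$ contains an element that originates in the $j$-th position. Each position of $\mathcal{W}$ is designated: $\rho$ if it is red but not lime; $\lambda$ if it is lime but not red; $\beta$ if it is both red and lime; $\nu$ if it is neither red nor lime. The signature of $\mathcal{W}$ is the resulting $n$-tuple of symbols. ''To the right of'' a position means at positions with strictly larger index. *)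

(* Defs.v *)
From HB Require Import structures.
From mathcomp Require Import all_boot all_algebra.
From mathcomp Require Import boolp.

Set Implicit Arguments.
Unset Strict Implicit.
Unset Printing Implicit Defensive.

Import GRing.Theory.
Local Open Scope ring_scope.

Inductive symbol : Type := rho | lambda | beta | nu.

Definition symbol_eq (a b : symbol) : bool :=
  match a, b with
  | rho, rho | lambda, lambda | beta, beta | nu, nu => true
  | _, _ => false
  end.

Lemma symbol_eqP : Equality.axiom symbol_eq.
Proof. by case; case; constructor. Qed.

HB.instance Definition _ := hasDecEq.Build symbol symbol_eqP.

(* Positions 1, ..., n are indexed from 0, as elements of 'I_n. *)

Definition terminates (F : fieldType) (n : nat) (v : 'rV[F]_n) (j : 'I_n) : Prop :=
  v 0 j != 0 /\ forall i : 'I_n, (j < i)%N -> v 0 i = 0.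

Definition originates (F : fieldType) (n : nat) (v : 'rV[F]_n) (j : 'I_n) : Prop :=
  v 0 j != 0 /\ forall i : 'I_n, (i < j)%N -> v 0 i = 0.

Definition red (F : fieldType) (n : nat) (W : {vspace 'rV[F]_n}) (j : 'I_n) : Prop :=
  exists2 v : 'rV[F]_n, v \in W & terminates v j.

Definition lime (F : fieldType) (n : nat) (W : {vspace 'rV[F]_n}) (j : 'I_n) : Prop :=
  exists2 v : 'rV[F]_n, v \in W & originates v j.

Definition designation (F : fieldType) (n : nat) (W : {vspace 'rV[F]_n})
    (j : 'I_n) : symbol :=
  match `[< red W j >], `[< lime W j >] with
  | true, false => rho
  | false, true => lambda
  | true, true => beta
  | false, false => nu
  end.

Definition signature (F : fieldType) (n : nat) (W : {vspace 'rV[F]_n}) :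
    n.-tuple symbol :=
  [tuple designation W j | j < n].

(* Main.v *)
Require Import Defs.
From HB Require Import structures.
From mathcomp Require Import all_boot all_algebra.
From mathcomp Require Import boolp zify.

Import GRing.Theory.

(** For the necessity, order the positions and put W in echelon form: the
dimension of W is the number of positions at which some vector of W has its
leading entry.  Reading from the left this counts the lime positions, reading
from the right the red ones, so there are as many lambdas as rhos, the betas
being counted on both sides.  The same count inside a coordinate subspace
([dim_leads]) says that R, the vectors of W supported to the right of i, has
dimension the number of lime positions to the right of i, and that L, the
vectors supported on the positions up to i, has dimension the number of red
positions up to i.  Now R and L are independent in W, so the former number is
at most the number of red positions to the right of i.  If i is lime but not
red the inequality is strict: were W = R + L, the L-component of a vector that
originates at i would have its only non-zero entry at i, and i would be red
([card_lime_red_right]).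

For the sufficiency, pair the k-th lambda from the right with the k-th rho from
the right.  The two conditions make this a perfect matching in which each lambda
precedes its rho, as with balanced parentheses.  Let W consist of
the vectors that vanish at the nu positions and take equal values at the two
ends of each pair.  The vectors e_i + e_j for a pair (i, j) and e_j for a beta
position j show that the required positions are lime and red; there are no
others, since a non-zero entry at a rho position is repeated further left and
one at a lambda position is repeated further right. *)

(** * Leading positions and dimension *)

Section Entries.

Variables (F : fieldType) (n : nat).
Local Open Scope ring_scope.
Set Implicit Arguments.
Unset Strict Implicit.
Unset Printing Implicit Defensive.

Definition entry (j : 'I_n) (v : 'rV[F]_n) : F^o := v 0 j.

Fact entry_is_linear j : linear (entry j).
Proof. by move=> a u v; rewrite /entry !mxE. Qed.

HB.instance Definition _ j :=
  GRing.isLinear.Build F 'rV[F]_n F^o _ (entry j) (entry_is_linear j).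

Definition entryf (j : 'I_n) : 'Hom('rV[F]_n, F^o) := linfun (entry j).

Lemma entryfE j (v : 'rV[F]_n) : entryf j v = v 0 j.
Proof. by rewrite lfunE. Qed.

Definition vanish (A : {set 'I_n}) : {vspace 'rV[F]_n} :=
  (\bigcap_(j in A) lker (entryf j))%VS.

Lemma memv_bigcap (I : finType) (P : pred I) (U : I -> {vspace 'rV[F]_n}) (v : 'rV[F]_n) :
  reflect (forall i, P i -> v \in U i) (v \in (\bigcap_(i | P i) U i)%VS).
Proof.
rewrite memvE; apply: (iffP subv_bigcapP) => h i /h; by rewrite memvE.
Qed.

Lemma vanishP (A : {set 'I_n}) (v : 'rV[F]_n) :
  reflect (forall j, j \in A -> v 0 j = 0) (v \in vanish A).
Proof.
apply: (iffP (memv_bigcap _ _ _)) => h j /h.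
  by rewrite memv_ker entryfE => /eqP.
by rewrite memv_ker entryfE => ->.
Qed.

(** The image of U under the j-th coordinate is a subspace of the line F, so
rank-nullity loses one dimension or none. *)
Lemma dim_cap_ker_entry (U : {vspace 'rV[F]_n}) (j : 'I_n) :
  \dim U = (`[< exists2 v : 'rV[F]_n, v \in U & (v 0 j != 0)%R >] + \dim (U :&: lker (entryf j)))%N.
Proof.
rewrite -(limg_ker_dim (entryf j) U) addnC; congr (_ + _)%N.
have [[v vU vj]|no_v] := asboolP.
  have -> : (entryf j @: U = fullv)%VS; last by rewrite dimvf.
  apply/eqP; rewrite eqEsubv subvf /=; apply/subvP => x _.
  have -> : x = (x / v 0 j) *: entryf j v by rewrite entryfE -[RHS]/(_ * _) divfK.
  by rewrite memvZ // memv_img.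
apply/eqP; rewrite dimv_eq0 -lkerE; apply/subvP => v vU.
rewrite memv_ker entryfE; apply/eqP; apply: contrapT => /eqP vj.
by apply: no_v; exists v.
Qed.

(** The order of the positions is given by an injective weight f, so that the
inclusion in nat yields the lime positions and a decreasing weight the red
ones. *)
Definition leads (f : 'I_n -> nat) (W : {vspace 'rV[F]_n}) (j : 'I_n) : bool :=
  `[< exists2 v : 'rV[F]_n, v \in W & v 0 j != 0 /\ forall i, (f i < f j)%N -> v 0 i = 0 >].

(** Remove from A its position i of least weight.  The dimension drops by one
exactly when some vector of W that vanishes off A is non-zero at i; since A is
upward closed, the positions off A are those lighter than i, so this happens
exactly when i is a leading position. *)
Lemma dim_leads (f : 'I_n -> nat) (W : {vspace 'rV[F]_n}) (A : {set 'I_n}) :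
    injective f -> (forall i j, i \in A -> (f i <= f j)%N -> j \in A) ->
  \dim (W :&: vanish (~: A)) = #|[set j in A | leads f W j]|.
Proof.
move=> f_inj; have [m] := ubnP #|A|; elim: m A => // m IHm A cardA A_up.
have [->|[i0 i0A]] := set_0Vmem A.
  rewrite [X in #|pred_of_set X|](_ : _ = set0) ?cards0; last first.
    by apply/setP => j; rewrite !inE.
  apply/eqP; rewrite dimv_eq0 -subv0; apply/subvP => v /memv_capP[_ /vanishP v0].
  by rewrite memv0; apply/eqP/rowP => j; rewrite mxE v0 // !inE.
have [i /= iA i_min] : exists2 i, i \in A & forall j, j \in A -> (f i <= f j)%N.
  by case: (arg_minnP f i0A) => i; exists i.
have ltA : (#|A :\ i| < m)%N by move: cardA; rewrite (cardsD1 i A) iA.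
have IH : \dim (W :&: vanish (~: (A :\ i))) = #|[set j in A :\ i | leads f W j]|.
  apply: IHm ltA _ => k j; rewrite !inE => /andP[ki kA] fkj.
  (* If j = i then f k = f i by minimality, so k = i by injectivity. *)
  rewrite (A_up _ _ kA fkj) andbT; apply: contraNneq ki => ji.
  by apply/eqP/f_inj/eqP; rewrite eqn_leq -{1}ji fkj i_min.
rewrite (dim_cap_ker_entry _ i) -capvA.
have -> : (vanish (~: A) :&: lker (entryf i))%VS = vanish (~: (A :\ i)).
  by rewrite setCD setUC /vanish big_setU1 ?inE ?iA //= capvC.
rewrite IH [in RHS](cardsD1 i) inE iA /=; congr (_ + _)%N; last first.
  by apply: eq_card => j; rewrite !inE andbA.
congr nat_of_bool; apply: asbool_equiv_eq; split.
  case=> v /memv_capP[vW /vanishP v0] vi; exists v => //; split=> // k fki.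
  by apply: v0; rewrite inE; apply: contraL fki => /i_min; rewrite -leqNgt.
case=> v vW [vi v0]; exists v => //; apply/memv_capP; split=> //.
apply/vanishP => k; rewrite inE => kA; apply: v0; rewrite ltnNge.
by apply: contra kA => /A_up; apply.
Qed.

Lemma dim_lime (W : {vspace 'rV[F]_n}) m :
  \dim (W :&: vanish [set j : 'I_n | (j < m)%N])
    = #|[set j : 'I_n | (m <= j)%N && `[< lime W j >]]|.
Proof.
have := @dim_leads (@nat_of_ord n) W [set j : 'I_n | (m <= j)%N] (@ord_inj n).
have -> : ~: [set j : 'I_n | (m <= j)%N] = [set j : 'I_n | (j < m)%N].
  by apply/setP => j; rewrite !inE ltnNge.
move=> ->; last by move=> i j; rewrite !inE => /leq_trans; apply.
by apply: eq_card => j; rewrite !inE.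
Qed.

Lemma dim_red (W : {vspace 'rV[F]_n}) m :
  \dim (W :&: vanish [set j : 'I_n | (m <= j)%N])
    = #|[set j : 'I_n | (j < m)%N && `[< red W j >]]|.
Proof.
have rev_inj : injective (fun j : 'I_n => n - j)%N.
  by move=> i j /= ij; apply: ord_inj; have := ltn_ord i; have := ltn_ord j; lia.
have := @dim_leads _ W [set j : 'I_n | (j < m)%N] rev_inj.
have -> : ~: [set j : 'I_n | (j < m)%N] = [set j : 'I_n | (m <= j)%N].
  by apply/setP => j; rewrite !inE -leqNgt.
move=> ->; last by move=> i j; rewrite !inE; have := ltn_ord i; lia.
apply: eq_card => j; rewrite !inE; congr (_ && _); apply: asbool_equiv_eq.
split=> -[v vW [vj v0]]; exists v => //; split=> // i ij; apply: v0.
  by have := ltn_ord i; lia.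
by lia.
Qed.

Lemma card_lime_red (W : {vspace 'rV[F]_n}) :
  #|[set j | `[< lime W j >]]| = #|[set j | `[< red W j >]]|.
Proof.
have := dim_lime W 0; have := dim_red W n.
have -> : [set j : 'I_n | (n <= j)%N] = set0.
  by apply/setP => j; rewrite !inE leqNgt ltn_ord.
have -> : [set j : 'I_n | (j < 0)%N] = set0 by apply/setP => j; rewrite !inE.
move=> -> E; transitivity #|[set j : 'I_n | (j < n)%N && `[< red W j >]]|.
  by rewrite E; apply: eq_card => j; rewrite !inE.
by apply: eq_card => j; rewrite !inE ltn_ord.
Qed.

(** The vectors of W supported to the right of i and those supported on the
positions up to i are independent, and their sum R + L is a proper subspace of
W: it misses the vectors that originate at i, since the L-component of such a
vector would be supported at i alone and make i red. *)
Lemma card_lime_red_right (W : {vspace 'rV[F]_n}) (i : 'I_n) :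
    lime W i -> ~ red W i ->
  (#|[set j : 'I_n | (i < j)%N && `[< lime W j >]]|
    < #|[set j : 'I_n | (i < j)%N && `[< red W j >]]|)%N.
Proof.
move=> [w wW [wi w0]] not_red.
pose R := (W :&: vanish [set j : 'I_n | (j < i.+1)%N])%VS.
pose L := (W :&: vanish [set j : 'I_n | (i.+1 <= j)%N])%VS.
have dimW : \dim W = #|[set j | `[< red W j >]]|.
  rewrite -card_lime_red; have := dim_lime W 0.
  have -> : [set j : 'I_n | (j < 0)%N] = set0 by apply/setP => j; rewrite !inE.
  rewrite /vanish big_set0 capvf => ->.
  by apply: eq_card => j; rewrite !inE.
have RL0 : (R :&: L = 0)%VS.
  apply/eqP; rewrite -subv0; apply/subvP => v.
  rewrite !memv_cap => /andP[/andP[_ /vanishP vR] /andP[_ /vanishP vL]].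
  rewrite memv0; apply/eqP/rowP => j; rewrite mxE.
  by have [ij|ij] := leqP i.+1 j; [apply: vL|apply: vR]; rewrite inE.
have RLW : (R + L <= W)%VS by rewrite subv_add !capvSl.
have wRL : w \notin (R + L)%VS.
  apply/negP => /memv_addP[a /memv_capP[_ /vanishP a0]].
  move=> [b /memv_capP[bW /vanishP b0] wE]; apply: not_red; exists b => //.
  split=> [|j ij]; last by apply: b0; rewrite inE.
  by move: wi; rewrite wE mxE a0 ?inE // add0r.
have ltW : (\dim R + \dim L < \dim W)%N.
  rewrite -dimv_disjoint_sum // ltn_neqAle (dimvS RLW) andbT.
  by rewrite (dimv_leqif_eq RLW); apply: contra wRL => /eqP ->.
move: ltW; rewrite dimW dim_lime dim_red.
rewrite -(cardsID [set j : 'I_n | (i < j)%N] [set j | `[< red W j >]]).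
have -> : [set j | `[< red W j >]] :&: [set j : 'I_n | (i < j)%N]
    = [set j : 'I_n | (i < j)%N && `[< red W j >]].
  by apply/setP => j; rewrite !inE andbC.
have -> : [set j | `[< red W j >]] :\: [set j : 'I_n | (i < j)%N]
    = [set j : 'I_n | (j < i.+1)%N && `[< red W j >]].
  by apply/setP => j; rewrite !inE -leqNgt.
by rewrite ltn_add2r.
Qed.

Lemma designation_lime (W : {vspace 'rV[F]_n}) j :
  `[< lime W j >] = (designation W j == lambda) || (designation W j == beta).
Proof. by rewrite /designation; case: `[< red _ _ >]; case: `[< lime _ _ >]. Qed.

Lemma designation_red (W : {vspace 'rV[F]_n}) j :
  `[< red W j >] = (designation W j == rho) || (designation W j == beta).
Proof. by rewrite /designation; case: `[< red _ _ >]; case: `[< lime _ _ >]. Qed.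

End Entries.

(** * Counting positions by symbol and by rank *)

Section Configurations.

Variables (F : fieldType) (n : nat).
Local Open Scope ring_scope.
Set Implicit Arguments.
Unset Strict Implicit.
Unset Printing Implicit Defensive.

Lemma card_add_beta (P : pred 'I_n) (d : 'I_n -> symbol) (s : symbol) :
    s != beta ->
  #|[set j | P j && ((d j == s) || (d j == beta))]|
    = (#|[set j | P j && (d j == s)]| + #|[set j | P j && (d j == beta)]|)%N.
Proof.
move=> s_beta; rewrite -(cardsID [set j | d j == s]); congr (_ + _)%N.
  by apply: eq_card => j; rewrite !inE; case: (d j == s); rewrite ?andbF ?andbT.
apply: eq_card => j; rewrite !inE; case: eqP => [->|_] //=.
by rewrite (negbTE s_beta) andbF.
Qed.

(** For i in P this is the rank of i in P, counted from the right and starting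
at 0. *)
Definition rightn (P : pred 'I_n) (i : 'I_n) : nat :=
  #|[set j : 'I_n | (i < j)%N && P j]|.

Lemma rightn_le (P : pred 'I_n) (i j : 'I_n) :
  (i <= j)%N -> (rightn P j <= rightn P i)%N.
Proof.
move=> ij; apply/subset_leq_card/subsetP => k; rewrite !inE.
by case/andP=> jk ->; rewrite (leq_ltn_trans ij jk).
Qed.

Lemma rightn_lt (P : pred 'I_n) (i j : 'I_n) :
  P j -> (i < j)%N -> (rightn P j < rightn P i)%N.
Proof.
move=> Pj ij; apply/proper_card/properP; split.
  by apply/subsetP => k; rewrite !inE => /andP[jk ->]; rewrite (ltn_trans ij jk).
by exists j; rewrite !inE ?ij ?Pj // ltnn.
Qed.

Lemma rightn_inj (P : pred 'I_n) (i j : 'I_n) :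
  P i -> P j -> rightn P i = rightn P j -> i = j.
Proof.
move=> Pi Pj eq_ij; apply: ord_inj.
case: (ltngtP i j) => // [/(rightn_lt Pj)|/(rightn_lt Pi)];
  by rewrite eq_ij ltnn.
Qed.

Lemma rightn_lt_card (P : pred 'I_n) (i : 'I_n) :
  P i -> (rightn P i < #|[set j | P j]|)%N.
Proof.
move=> Pi; apply/proper_card/properP; split.
  by apply/subsetP => k; rewrite !inE => /andP[].
by exists i; rewrite !inE ?Pi // ltnn.
Qed.

(** The rank is injective on P and takes values below #|P|, so by counting it
takes all of them. *)
Lemma rightn_surj (P : pred 'I_n) k :
  (k < #|[set j | P j]|)%N -> exists2 j, P j & rightn P j = k.
Proof.
set A := [set j | P j] => ltkA.
(* The spare element #|A| makes the codomain inhabited, so that inord applies. *)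
pose r (j : 'I_n) : 'I_#|A|.+1 := inord (rightn P j).
have rA j : P j -> r j = rightn P j :> nat.
  by move=> Pj; rewrite inordK // ltnW // ltnS rightn_lt_card.
have r_inj : {in A &, injective r}.
  move=> i j; rewrite !inE => Pi Pj /(congr1 val) /=.
  by rewrite !rA //; apply: rightn_inj.
pose B := [set k : 'I_#|A|.+1 | (k < #|A|)%N].
have rB : r @: A = B.
  apply/eqP; rewrite eqEcard card_in_imset //; apply/andP; split.
    apply/subsetP => _ /imsetP[j jA ->]; move: jA; rewrite !inE => Pj.
    by rewrite rA // rightn_lt_card.
  rewrite -ltnS -[X in (_ < X)%N]card_ord -cardsT; apply: proper_card.
  by apply/properP; split; [apply: subsetT|exists ord_max; rewrite !inE ?ltnn].
have : inord k \in r @: A by rewrite rB inE inordK // ltnW.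
case/imsetP => j; rewrite inE => Pj /(congr1 val) /=.
by rewrite inordK 1?ltnW // rA // => ->; exists j.
Qed.

(** * The subspace of a balanced configuration *)

Variable c : n.-tuple symbol.

Let marked s := [pred j : 'I_n | tnth c j == s].

Hypothesis card_eq : #|[set j | marked lambda j]| = #|[set j | marked rho j]|.
Hypothesis right_lt : forall i : 'I_n, marked lambda i ->
  (rightn (marked lambda) i < rightn (marked rho) i)%N.

Definition paired (i j : 'I_n) : bool :=
  [&& marked lambda i, marked rho j & rightn (marked lambda) i == rightn (marked rho) j].

(** If j <= i then the rank of j among the rhos is at least the number of rhos to
the right of i, which exceeds the rank of the lambda at i. *)
Lemma paired_lt i j : paired i j -> (i < j)%N.
Proof.
case/and3P=> li _ /eqP eq_ij; rewrite ltnNge; apply/negP => /(rightn_le (marked rho)).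
by rewrite -eq_ij leqNgt right_lt.
Qed.

Lemma paired_lambda i : marked lambda i -> exists j, paired i j.
Proof.
move=> li; have := rightn_lt_card li; rewrite card_eq => /rightn_surj[j rj eq_j].
by exists j; rewrite /paired li rj eq_j eqxx.
Qed.

Lemma paired_rho j : marked rho j -> exists i, paired i j.
Proof.
move=> rj; have := rightn_lt_card rj; rewrite -card_eq => /rightn_surj[i li eq_i].
by exists i; rewrite /paired li rj eq_i eqxx.
Qed.

Lemma paired_injl i i' j : paired i j -> paired i' j -> i = i'.
Proof.
case/and3P=> li _ /eqP e /and3P[li' _ /eqP e'].
by apply: (rightn_inj li li'); rewrite e e'.
Qed.

Lemma paired_injr i j j' : paired i j -> paired i j' -> j = j'.
Proof.
case/and3P=> _ rj /eqP e /and3P[_ rj' /eqP e'].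
by apply: (rightn_inj rj rj'); rewrite -e -e'.
Qed.

Definition pair_space : {vspace 'rV[F]_n} :=
  (vanish F [set j | marked nu j] :&:
   \bigcap_(p : 'I_n * 'I_n | paired p.1 p.2) lker (entryf F p.1 - entryf F p.2))%VS.

Lemma pair_spaceP (v : 'rV[F]_n) :
  reflect ((forall j, marked nu j -> v 0 j = 0) /\
           (forall i j, paired i j -> v 0 i = v 0 j)) (v \in pair_space).
Proof.
apply: (iffP (@memv_capP _ _ _ _ _)) => -[v_nu v_pair]; split.
- by move=> j nuj; apply: (vanishP _ _ v_nu); rewrite inE.
- move=> i j pij; have := memv_bigcap _ _ _ v_pair (i, j) pij.
  by rewrite memv_ker /= add_lfunE opp_lfunE !entryfE subr_eq0 => /eqP.
- by apply/vanishP => j; rewrite inE; apply: v_nu.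
apply/memv_bigcap => -[i j] /= /v_pair eq_v.
by rewrite memv_ker add_lfunE opp_lfunE !entryfE eq_v subrr.
Qed.

Lemma pair_space_beta j : marked beta j -> delta_mx 0 j \in pair_space.
Proof.
move=> /eqP bj; apply/pair_spaceP; split=> [k /eqP nk|i k /and3P[/eqP li /eqP rk _]].
  by rewrite mxE eqxx /=; have [kj|_] := eqVneq k j; first by rewrite kj bj in nk.
rewrite !mxE eqxx /=; have [ij|_] := eqVneq i j; first by rewrite -ij li in bj.
by have [kj|_] := eqVneq k j; first by rewrite -kj rk in bj.
Qed.

Lemma pair_space_paired i j :
  paired i j -> delta_mx 0 i + delta_mx 0 j \in pair_space.
Proof.
move=> pij; have /and3P[/eqP li /eqP rj _] := pij.
have neq x y : marked lambda x -> marked rho y -> (x == y) = false.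
  by move=> /eqP lx /eqP ry; apply/eqP => xy; rewrite xy ry in lx.
apply/pair_spaceP; split=> [k /eqP nk|i' j' pij'].
  rewrite !mxE eqxx /=; have [ki|_] := eqVneq k i; first by rewrite ki li in nk.
  have [kj|_] := eqVneq k j; first by rewrite kj rj in nk.
  by rewrite addr0.
have /and3P[li' rj' _] := pij'.
rewrite !mxE eqxx /= (neq i' j) ?(eq_sym j') ?(neq i j') ?inE ?li ?rj //.
have [ii|ii] := eqVneq i' i; have [jj|jj] := eqVneq j j' => //=.
- by rewrite addrC.
- by rewrite ii in pij'; rewrite (paired_injr pij pij') eqxx in jj.
by rewrite -jj in pij'; rewrite (paired_injl pij' pij) eqxx in ii.
Qed.

(** A vector of this space cannot originate at a rho, because its entry there is repeated at
the lambda paired with it, further left. *)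
Lemma lime_pair_space j :
  `[< lime pair_space j >] = marked lambda j || marked beta j.
Proof.
apply/asboolP/idP => [[v /pair_spaceP[v_nu v_pair] [vj v0]]|].
  have := @paired_rho j; have := v_nu j; rewrite /=.
  case: (tnth c j) => //= [_ /(_ isT)[i pij]|/(_ isT) vj0 _].
    by rewrite -(v_pair _ _ pij) v0 ?eqxx // paired_lt in vj.
  by rewrite vj0 eqxx in vj.
case/orP => [/paired_lambda[k pjk]|bj].
  have jk := paired_lt pjk; exists (delta_mx 0 j + delta_mx 0 k).
    exact: pair_space_paired.
  split=> [|i ij]; rewrite !mxE !eqxx /=.
    by rewrite -val_eqE /= ltn_eqF // addr0 oner_eq0.
  by rewrite -!val_eqE /= !ltn_eqF ?addr0 // (ltn_trans ij).
exists (delta_mx 0 j); first exact: pair_space_beta.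
split=> [|i ij]; first by rewrite mxE !eqxx oner_eq0.
by rewrite mxE eqxx -val_eqE /= ltn_eqF.
Qed.

Lemma red_pair_space j :
  `[< red pair_space j >] = marked rho j || marked beta j.
Proof.
apply/asboolP/idP => [[v /pair_spaceP[v_nu v_pair] [vj v0]]|].
  have := @paired_lambda j; have := v_nu j; rewrite /=.
  case: (tnth c j) => //= [_ /(_ isT)[i pij]|/(_ isT) vj0 _].
    by rewrite (v_pair _ _ pij) v0 ?eqxx // paired_lt in vj.
  by rewrite vj0 eqxx in vj.
case/orP => [/paired_rho[k pkj]|bj].
  have kj := paired_lt pkj; exists (delta_mx 0 k + delta_mx 0 j).
    exact: pair_space_paired.
  split=> [|i ji]; rewrite !mxE !eqxx /=.
    by rewrite -val_eqE /= gtn_eqF // add0r oner_eq0.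
  by rewrite -!val_eqE /= !gtn_eqF ?addr0 // (ltn_trans kj).
exists (delta_mx 0 j); first exact: pair_space_beta.
split=> [|i ij]; first by rewrite mxE !eqxx oner_eq0.
by rewrite mxE eqxx -val_eqE /= gtn_eqF.
Qed.

Lemma signature_pair_space : signature pair_space = c.
Proof.
apply: eq_from_tnth => j; rewrite tnth_mktuple /designation.
by rewrite lime_pair_space red_pair_space /=; case: (tnth c j).
Qed.

End Configurations.

(** * Signatures *)

Theorem theorem9p2 (F : fieldType) (n : nat) (c : n.-tuple symbol) :
  (exists W : {vspace 'rV[F]_n}, signature W = c) <->
  (#|[set j : 'I_n | tnth c j == lambda]| = #|[set j : 'I_n | tnth c j == rho]|
   /\ forall i : 'I_n, tnth c i = lambda ->
        #|[set j : 'I_n | (i < j)%N && (tnth c j == lambda)]| <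
        #|[set j : 'I_n | (i < j)%N && (tnth c j == rho)]|).
Proof.
split=> [[W <-]|[card_eq right_lt]]; last first.
  exists (pair_space F c); apply: signature_pair_space => // i /eqP.
  exact: right_lt.
have sigE s (P : pred 'I_n) : [set j | P j && (tnth (signature W) j == s)]
    = [set j | P j && (designation W j == s)].
  by apply/setP => j; rewrite !inE tnth_mktuple.
have limeE (P : pred 'I_n) : [set j | P j && `[< lime W j >]]
    = [set j | P j && ((designation W j == lambda) || (designation W j == beta))].
  by apply/setP => j; rewrite !inE designation_lime.
have redE (P : pred 'I_n) : [set j | P j && `[< red W j >]]
    = [set j | P j && ((designation W j == rho) || (designation W j == beta))].
  by apply/setP => j; rewrite !inE designation_red.
split=> [|i].
  have := card_lime_red W.
  rewrite (limeE predT) (redE predT) !card_add_beta // => /addIn.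
  by rewrite (sigE _ predT) (sigE _ predT).
rewrite tnth_mktuple => lambda_i.
have lime_i : lime W i by apply/asboolP; rewrite designation_lime lambda_i.
have not_red : ~ red W i by move=> /asboolP; rewrite designation_red lambda_i.
have := card_lime_red_right lime_i not_red.
rewrite (limeE [pred j : 'I_n | i < j]) (redE [pred j : 'I_n | i < j]).
rewrite !card_add_beta // ltn_add2r.
by rewrite (sigE _ [pred j : 'I_n | i < j]) (sigE _ [pred j : 'I_n | i < j]).
Qed.
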